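(* Every directed cycle $C$ of length at least $3$ satisfies $\dim(C)\in\{3,4\}$, and both values occur (there are directed cycles with weak majority dimension $3$ and directed cycles with weak majority dimension $4$).
   Context: All digraphs are finite and have simple underlying graphs (so directed cycles have length at least $3$). A directed cycle of length $n$ is a digraph $v_1\to v_2\to\cdots\to v_n\to v_1$ with arc set exactly $\{(v_i,v_{i+1}):1\le i<n\}\cup\{(v_n,v_1)\}$. For an integer $d\ge 0$ write $[d]=\{1,\dots,d\}$ (with $\mathbb{R}^0=\{0\}$). For $x,y\in\mathbb{R}^d$ let $\mathcal{G}_{x>y}=\{i\in[d]: x_i>y_i\}$. The weak majority relation: $x\succ y$ iff $|\mathcal{G}_{x>y}|-|\mathcal{G}_{y>x}|>0$. A map $f:V(D)\to\mathbb{R}^d$ is an $\mathbb{R}^d$-realizer of $D$ if for all vertices $x,y$: $(x,y)\in A(D)$ iff $f(x)\succ f(y)$. The weak majority dimension $\dim(D)$ is the minimum nonnegative integer $d$ such that $D$ has an $\mathbb{R}^d$-realizer (such $d$ always exists). *)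

(* Defs.v *)
From mathcomp Require Import all_boot all_order all_algebra.
From mathcomp Require Import reals.

Set Implicit Arguments.
Unset Strict Implicit.
Unset Printing Implicit Defensive.

Import Order.TTheory GRing.Theory Num.Theory.

(* Asymmetry of the arc relation is exactly simplicity of the underlying graph:
   it excludes both loops (take x = y) and pairs of opposite arcs. *)
Record digraph := Digraph {
  vertex :> finType;
  arc : rel vertex;
  arc_asym : forall x y : vertex, arc x y -> ~~ arc y x
}.

(* v lists the vertices without repetition; indices are 0, ..., n-1 rather than
   1, ..., n, so the successor of the last index is 0. *)
Definition directed_cycle (D : digraph) (n : nat) : Prop :=
  exists v : 'I_n -> D,
    bijective v /\
    forall i j : 'I_n,
      arc (v i) (v j) = (j == i.+1 :> nat) || (i.+1 == n) && (j == 0 :> nat).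

Section WeakMajority.
Variable R : realType.

Definition gt_coords (d : nat) (x y : 'rV[R]_d) : {set 'I_d} :=
  [set i | (y 0 i < x 0 i)%R].

Definition weak_majority (d : nat) (x y : 'rV[R]_d) : bool :=
  (0 < #|gt_coords x y|%:Z - #|gt_coords y x|%:Z)%R.

Definition realizer (D : digraph) (d : nat) (f : D -> 'rV[R]_d) : Prop :=
  forall x y : D, arc x y <-> weak_majority (f x) (f y).

Definition realizable (D : digraph) (d : nat) : Prop :=
  exists f : D -> 'rV[R]_d, realizer f.

(* The dimension as a relation: has_dim D d reads "dim(D) = d". *)
Definition has_dim (D : digraph) (d : nat) : Prop :=
  realizable D d /\ forall d' : nat, realizable D d' -> d <= d'.

End WeakMajority.

(* Main.v *)
Require Import Defs.
From mathcomp Require Import all_boot all_order all_algebra.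
From mathcomp Require Import reals.
From mathcomp Require Import boolp zify.

(** In dimension at most 2, x ≻ y forces x >= y coordinatewise, so a directed
    cycle needs dimension at least 3. Dimension 4 suffices for n >= 4: the first
    two coordinates realize a partial order containing every other arc, the last
    two one containing the remaining arcs, and when n is odd each contains one
    extra comparison, between the same two vertices but in opposite directions.
    The triangle is Condorcet's paradox with three voters.
    For the 12-cycle in dimension 3, two non-adjacent vertices agree in exactly
    one coordinate, and five pairwise non-adjacent vertices then agree in a
    common one. Applied to {4, 6, 8, 10} with 0, 1 or 2 added, this gives
    one coordinate shared by 0, 1 and 2; so 0 -> 1 -> 2 is a chain
    in the product order of the other two coordinates, and 0 cannot tie with 2. *)

Set Implicit Arguments.
Unset Strict Implicit.
Unset Printing Implicit Defensive.

Import Order.TTheory GRing.Theory Num.Theory.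

Lemma card_set_sum (T : finType) (P : pred T) : #|[set i | P i]| = \sum_i P i.
Proof. by rewrite -sum1dep_card big_mkcond; apply: eq_bigr => i _; case: (P i). Qed.

(** * Weak majority and coordinatewise order *)

Section Coordinates.
Variables (R : realType) (d : nat).
Implicit Types x y : 'rV[R]_d.

Definition eq_coords x y : {set 'I_d} := [set i | x 0%R i == y 0%R i].

Lemma weak_majorityE x y :
  weak_majority x y = (#|gt_coords y x| < #|gt_coords x y|).
Proof. by rewrite /weak_majority subr_gt0 ltz_nat. Qed.

Lemma card_coords x y :
  #|gt_coords x y| + #|gt_coords y x| + #|eq_coords x y| = d.
Proof.
rewrite !card_set_sum -!big_split /= -[RHS]card_ord -sum1_card.
by apply: eq_bigr => i _; case: ltgtP.
Qed.

(** At most two coordinates are not tied, so a strict majority among them leaves none in favour of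
    [y]. *)
Lemma weak_majority_le x y :
  d <= #|eq_coords x y| + 2 -> weak_majority x y ->
  forall i, (y 0 i <= x 0 i)%R.
Proof.
rewrite weak_majorityE => hd lt_yx i; have card_xy := card_coords x y.
have /eqP : #|gt_coords y x| = 0 by lia.
by rewrite cards_eq0 => /eqP/setP/(_ i); rewrite !inE ltNge => /negbFE.
Qed.

Lemma le_tie_eq x y :
  (forall i, y 0 i <= x 0 i)%R -> ~~ weak_majority x y -> x = y.
Proof.
move=> le_yx; rewrite weak_majorityE -leqNgt.
have -> : gt_coords y x = set0.
  by apply/setP => i; rewrite !inE ltNge le_yx.
rewrite cards0 leqn0 cards_eq0 => /eqP gt0.
apply/rowP => i; apply/le_anti; rewrite le_yx andbT leNgt.
by have /setP/(_ i) := gt0; rewrite !inE => ->.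
Qed.

End Coordinates.

(** * Ties in dimension three *)

Section DimensionThree.
Variable R : realType.

(** In a tie the strict coordinates split evenly, so the number of equal ones is odd; three would
    give [x = y]. *)
Lemma tie_eq_coords (x y : 'rV[R]_3) :
  x != y -> ~~ weak_majority x y -> ~~ weak_majority y x ->
  #|eq_coords x y| = 1.
Proof.
move=> neq_xy; rewrite !weak_majorityE -!leqNgt => le_xy le_yx.
have card_xy := card_coords x y.
suff : #|eq_coords x y| != 3 by lia.
apply: contra neq_xy => /eqP card_eq; apply/eqP/rowP => i.
have /eqP/setP/(_ i) : eq_coords x y == setT.
  by rewrite eqEcard subsetT cardsT card_ord card_eq.
by rewrite !inE => /eqP.
Qed.

Variables (T : finType) (p : T -> 'rV[R]_3).

(** The agreeing coordinate colours the pairs of [A] with three colours. Agreement in a coordinate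
    is transitive, so a vertex with two edges of one colour closes a monochromatic triangle. *)
Lemma common_coord (A : {set T}) :
    4 < #|A| ->
    {in A &, forall u v, u != v -> #|eq_coords (p u) (p v)| = 1} ->
  exists c, {in A &, forall u v, p u 0%R c = p v 0%R c}.
Proof.
move=> gtA one; have /card_gt0P[t tA] : 0 < #|A| by lia.
(* The default [ord0] never occurs for distinct [u], [v] in [A], by [one]. *)
pose col u v := odflt ord0 [pick c in eq_coords (p u) (p v)].
have colP u v : u \in A -> v \in A -> u != v -> p u 0%R (col u v) = p v 0%R (col u v).
  move=> uA vA uv; rewrite /col; case: pickP => [c|none] /=.
    by rewrite inE => /eqP.
  by have := one u v uA vA uv; rewrite (eq_card0 none).
have pigeon w (B : {set T}) (K : {set 'I_3}) : #|K| < #|B| ->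
    {in B, forall u, col w u \in K} ->
    exists u v, [/\ u \in B, v \in B, u != v & col w u = col w v].
  move=> ltKB colK; have : ~~ dinjectiveb (col w) B.
    apply/negP => /dinjectiveP inj; move: ltKB; rewrite ltnNge.
    rewrite -(card_in_imset inj) subset_leq_card //.
    by apply/subsetP => _ /imsetP[u uB ->]; apply: colK.
  case/dinjectivePn => u uB [v /andP[vu vB] e].
  by exists u, v; split=> //; rewrite eq_sym.
have uniq_col u v c c' : u \in A -> v \in A -> u != v ->
    p u 0%R c = p v 0%R c -> p u 0%R c' = p v 0%R c' -> c = c'.
  move=> uA vA uv e e'; have /eqP/cards1P[k E] := one u v uA vA uv.
  have : c \in eq_coords (p u) (p v) by rewrite inE e.
  have : c' \in eq_coords (p u) (p v) by rewrite inE e'.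
  by rewrite E !inE => /eqP-> /eqP->.
(* At least four edges leave [t], in three colours: this gives the triangle [B] of colour [c]. *)
have [||i [j [iA jA ij cij]]] := pigeon t (A :\ t) setT.
- by rewrite cardsT card_ord; have := cardsD1 t A; rewrite tA; lia.
- by move=> u _; rewrite inE.
move: iA jA; rewrite !inE => /andP[it iA] /andP[jt jA].
have ci := colP t i tA iA; have cj := colP t j tA jA.
rewrite -cij !(eq_sym t) it jt in ci cj.
move: (col t i) (ci isT) (cj isT) => c {}ci {}cj {cij}.
pose B := t |: [set i; j].
have BA u : u \in B -> u \in A.
  by rewrite !inE => /or3P[] /eqP->.
have cB u : u \in B -> p u 0%R c = p t 0%R c.
  by rewrite !inE => /or3P[] /eqP->.
suff all_c w : w \in A -> p w 0%R c = p t 0%R c.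
  by exists c => u v uA vA; rewrite !all_c.
move=> wA; apply/eqP; apply: contraT => ncw.
have wB u : u \in B -> w != u.
  by move=> uB; apply: contra ncw => /eqP->; rewrite cB.
have colB u : u \in B -> p w 0%R (col w u) = p u 0%R (col w u).
  by move=> uB; apply: colP; rewrite ?wB // BA.
(* A vertex [w] off the class of [c] reaches the three vertices of [B] in two colours. A repeated
   one also joins [u] to [v], whose only colour is [c]. *)
have [||u [v [uB vB uv cuv]]] := pigeon w B [set~ c].
- by rewrite cardsC1 card_ord cardsU1 cards2 !inE ij !(eq_sym t) negb_or it jt.
- move=> u uB; rewrite !inE; apply: contra ncw => /eqP e.
  by rewrite -(cB u uB) -e colB.
have e : c = col w u.
  apply: (@uniq_col u v); rewrite ?BA ?cB //.
  by rewrite -colB // cuv colB.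
by case/negP: ncw; rewrite -(cB u uB) e colB.
Qed.

End DimensionThree.

(** * Cycles by index and the lower bound *)

Definition succ_mod n (i j : nat) : bool := (j == i.+1) || (i.+1 == n) && (j == 0).

Section Cycle.
Variable R : realType.

Definition cycle_embedding n d (g : 'I_n -> 'rV[R]_d) :=
  forall i j, weak_majority (g i) (g j) = succ_mod n i j.

Lemma realizable_cycle (C : digraph) n d : directed_cycle C n ->
  realizable R C d <-> exists g : 'I_n -> 'rV[R]_d, cycle_embedding g.
Proof.
case=> v [[w vK wK] arcE]; split=> [[f fP]|[g gP]].
  exists (f \o v) => i j; rewrite /succ_mod -arcE.
  by apply/idP/idP => /fP.
by exists (g \o w) => x y; rewrite /= gP /succ_mod -arcE !wK.
Qed.

Lemma dim_cycle_ge3 (C : digraph) n d : 3 <= n -> directed_cycle C n ->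
  realizable R C d -> 3 <= d.
Proof.
case: n => // n n3 cycC /(realizable_cycle d cycC)[g gP].
rewrite leqNgt; apply/negP => d2.
have chain (k : nat) (kn : k < n.+1) c : (g (Ordinal kn) 0 c <= g ord0 0 c)%R.
  elim: k kn => [|k IHk] kn.
    by rewrite (_ : Ordinal kn = ord0) //; apply: val_inj.
  apply: le_trans (IHk (ltnW kn)); apply: weak_majority_le; first by lia.
  by rewrite gP /succ_mod /= eqxx.
have last_gt : weak_majority (g ord_max) (g ord0).
  by rewrite gP /succ_mod /= eqxx.
(* Vertex 0 dominates the last vertex coordinatewise, but for [3 <= n] there is no arc from 0 to
   it. *)
have last_eq : g ord0 = g ord_max.
  apply: le_tie_eq => [c|]; first exact: chain (ltnSn n) c.
  by rewrite gP /succ_mod /=; lia.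
by move: last_gt; rewrite last_eq gP /succ_mod /=; lia.
Qed.

(** * Explicit integer realizers *)

Definition nat_row d (s : seq nat) : 'rV[R]_d := \row_k (nth 0 s k)%:R%R.

Lemma weak_majority_nat_row d s t :
  weak_majority (nat_row d s) (nat_row d t) =
  (\sum_(0 <= k < d) (nth 0 s k < nth 0 t k) <
   \sum_(0 <= k < d) (nth 0 t k < nth 0 s k)).
Proof.
rewrite weak_majorityE !card_set_sum !big_mkord.
by congr (_ < _); apply: eq_bigr => k _; rewrite !mxE ltr_nat.
Qed.

Lemma triangle_embedding : exists g : 'I_3 -> 'rV[R]_3, cycle_embedding g.
Proof.
exists (fun i => nat_row 3 (nth [::] [:: [:: 2; 1; 0]; [:: 1; 0; 2]; [:: 0; 2; 1]] i)).
move=> [i hi] [j hj]; rewrite weak_majority_nat_row unlock /=.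
by case: i hi => [|[|[|[]]]] // _; case: j hj => [|[|[|[]]]].
Qed.

(** The coordinates of a pair run in opposite directions and cancel, except where the halved one is
    constant: from even [i] to [i.+1] in the first pair, from odd [i] in the second. There vertex 0
    counts as [n], which makes the closing arc an ordinary step. *)
Definition even_coords n i :=
  [:: n - i; i./2; if i == 0 then 0 else n - i; if i == 0 then n./2 else i.+1./2].

(* The first pair of coordinates realizes i -> i+1 for i even and i < n-1, and
   the extra comparison 0 -> n-2; the second pair realizes the chain
   n-2 -> n-1 -> 0, whose composite n-2 -> 0 cancels it. *)
Definition odd_coords n i :=
  [:: if i == 0 then 4 else if i == 1 then 3 else 2 * (n - i);
      if i <= 1 then n./2 else if i == n.-1 then n./2.+1 else i./2;
      if i == 0 then 0 else n - i;
      if i == 0 then n./2 else i.+1./2].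

Lemma cycle_embedding4 n : 3 < n -> exists g : 'I_n -> 'rV[R]_4, cycle_embedding g.
Proof.
move=> n4; exists (fun i : 'I_n => nat_row 4 (if odd n then odd_coords n i else even_coords n i)).
move=> [i hi] [j hj]; rewrite weak_majority_nat_row unlock /succ_mod.
case: ifP => on; rewrite /odd_coords /even_coords /= !nth0 /= ?addn0; last first.
  by case: (eqVneq i 0) => i0; case: (eqVneq j 0) => j0; case: (ltngtP i j) => ij; lia.
have {}n4 : 4 < n by lia.
(* The formulas of [odd_coords] are exceptional only at 0, 1 and [n.-1]. *)
case: (eqVneq i 0) => i0; case: (eqVneq i 1) => i1; case: (eqVneq i n.-1) => il;
  case: (leqP i 1) => i2; try by exfalso; lia.
all: case: (eqVneq j 0) => j0; case: (eqVneq j 1) => j1; case: (eqVneq j n.-1) => jl;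
  case: (leqP j 1) => j2; try by exfalso; lia.
all: lia.
Qed.

Lemma cycle12_not_embedding3 (g : 'I_12 -> 'rV[R]_3) : ~ cycle_embedding g.
Proof.
move=> gP.
(* Equal images would give [u] and [v] the same successor [w]. *)
have g_inj u v : u != v -> g u != g v.
  apply: contra => /eqP e; apply/eqP/val_inj.
  have [w uw] : exists w : 'I_12, succ_mod 12 u w.
    have [u11|u11] := eqVneq (u : nat) 11.
      by exists ord0; rewrite /succ_mod u11.
    have lt_u : u.+1 < 12 by have := ltn_ord u; lia.
    by exists (Ordinal lt_u); rewrite /succ_mod /= eqxx.
  have : succ_mod 12 v w by rewrite -gP -e gP.
  by move: uw; rewrite /succ_mod /=; lia.
(* [S] is {4, 6, 8, 10}, which contains no neighbour of 0, 1 or 2. *)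
pose S := [set i : 'I_12 | (4 <= i) && ~~ odd i].
have share (x : 'I_12) : x < 3 ->
    exists c, {in x |: S &, forall u v, g u 0%R c = g v 0%R c}.
  move=> x3; apply: common_coord => [|u v uA vA uv].
    have xS : x \notin S by rewrite inE; lia.
    by rewrite cardsU1 xS card_set_sum !big_ord_recl big_ord0.
  have [nuv nvu] : ~~ succ_mod 12 u v /\ ~~ succ_mod 12 v u.
    move: uA vA uv; rewrite /succ_mod !inE -!val_eqE /=.
    have := ltn_ord u; have := ltn_ord v; lia.
  by apply: tie_eq_coords; rewrite ?gP ?g_inj.
pose pt k (lt_k : k < 12) : 'I_12 := Ordinal lt_k.
pose x0 := pt 0 isT; pose x1 := pt 1 isT; pose x2 := pt 2 isT.
pose s4 := pt 4 isT; pose s6 := pt 6 isT.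
have [c0 h0] := share x0 isT; have [c1 h1] := share x1 isT.
have [c2 h2] := share x2 isT.
(* Vertices 4 and 6 agree in [k] only, which forces [c0], [c1] and [c2] to coincide. *)
have /eqP/cards1P[k E] : #|eq_coords (g s4) (g s6)| = 1.
  by apply: tie_eq_coords; rewrite ?gP ?g_inj.
have inE4 c : g s4 0%R c = g s6 0%R c -> c = k.
  by move=> e; apply/set1P; rewrite -E inE e.
have toS x c : {in x |: S &, forall u v, g u 0%R c = g v 0%R c} -> g x 0%R k = g s4 0%R k.
  move=> h; have <- : c = k by apply: inE4; apply: h; rewrite !inE orbT.
  by apply: h; rewrite !inE ?eqxx ?orbT.
have le_k u v : g u 0%R k = g v 0%R k -> succ_mod 12 u v ->
    forall i, (g v 0 i <= g u 0 i)%R.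
  move=> e uv; apply: weak_majority_le; last by rewrite gP.
  by rewrite addn2 !ltnS card_gt0; apply/set0Pn; exists k; rewrite inE e.
have le01 := le_k x0 x1 (etrans (toS _ _ h0) (esym (toS _ _ h1))) isT.
have le12 := le_k x1 x2 (etrans (toS _ _ h1) (esym (toS _ _ h2))) isT.
suff e : g x0 = g x2 by have := g_inj x0 x2 isT; rewrite e eqxx.
by apply: le_tie_eq => [i|]; [apply: le_trans (le01 i) | rewrite gP].
Qed.

End Cycle.

(** * Concrete cycles and the two dimensions *)

Lemma arc_asym_succ_mod n : 2 < n ->
  forall i j : 'I_n, succ_mod n i j -> ~~ succ_mod n j i.
Proof. by move=> n3 i j; rewrite /succ_mod; lia. Qed.

Definition cycle_digraph n (n3 : 2 < n) : digraph :=
  Digraph (arc_asym_succ_mod n3).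

Lemma cycle_digraphP n (n3 : 2 < n) : directed_cycle (cycle_digraph n3) n.
Proof. by exists id; split=> //; exists id. Qed.

Theorem theorem4p5 (R : realType) :
  (forall (C : digraph) (n : nat), 3 <= n -> directed_cycle C n ->
     exists d : nat, has_dim R C d /\ d \in [:: 3; 4]) /\
  (exists (C : digraph) (n : nat),
     3 <= n /\ directed_cycle C n /\ has_dim R C 3) /\
  (exists (C : digraph) (n : nat),
     3 <= n /\ directed_cycle C n /\ has_dim R C 4).
Proof.
have dim3 C n : 2 < n -> directed_cycle C n -> realizable R C 3 -> has_dim R C 3.
  by move=> n3 cycC r3; split=> // d; apply: dim_cycle_ge3 cycC.
have dim4 C n : 2 < n -> directed_cycle C n -> ~ realizable R C 3 -> has_dim R C 4.
  move=> n3 cycC nr3; split=> [|d rd].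
    apply/(realizable_cycle R 4 cycC)/cycle_embedding4.
    (* Length 3 is excluded because the triangle is realizable in dimension 3. *)
    rewrite ltn_neqAle n3 andbT; apply/eqP => e; apply: nr3.
    by apply/(realizable_cycle R 3 cycC); rewrite -e; apply: triangle_embedding.
  have := dim_cycle_ge3 n3 cycC rd; rewrite leq_eqVlt => /predU1P[e|//].
  by case: nr3; rewrite e.
split; last split.
- move=> C n n3 cycC; case: (pselect (realizable R C 3)) => r3.
    by exists 3; split=> //; apply: dim3 cycC r3.
  by exists 4; split=> //; apply: dim4 cycC r3.
- have cycC := cycle_digraphP (isT : 2 < 3).
  exists (cycle_digraph (isT : 2 < 3)), 3; do 2!split=> //; apply: (dim3 _ 3) => //.
  by apply/(realizable_cycle R 3 cycC); apply: triangle_embedding.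
- have cycC := cycle_digraphP (isT : 2 < 12).
  exists (cycle_digraph (isT : 2 < 12)), 12; do 2!split=> //; apply: (dim4 _ 12) => //.
  by case/(realizable_cycle R 3 cycC) => g /cycle12_not_embedding3.
Qed.
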